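(* Let $G$ be an endorigid torsion-free abelian group. Then $s_0(G)=0$. In particular, $s(G)=ns(G)$, and the following conditions are equivalent: (a) $s(G)=0$; (b) $p^\omega G=0$ for all primes $p$.
   Context: $\mathbb N=\{0,1,2,\dots\}$ and $\mathbb N_+=\mathbb N\setminus\{0\}$. Let $\phi$ be an endomorphism of an abelian group $G$. A string of $\phi$ is a sequence $S=\{x_n\}_{n\in\mathbb N}$ of pairwise distinct elements of $G$ such that $\phi(x_n)=x_{n-1}$ for every $n\in\mathbb N_+$. A string is singular if $\phi^j(x_0)=\phi^k(x_0)$ for some $j\neq k$ in $\mathbb N$, and non-singular otherwise; it is a null string if $x_0\neq 0$ and $\phi^k(x_0)=0$ for some $k\in\mathbb N_+$. Define $s(\phi)$ (respectively $ns(\phi)$, $s_0(\phi)$) as the supremum of the cardinalities $|\mathcal F|$, where $\mathcal F$ ranges over the families of pairwise disjoint strings (respectively non-singular strings, null strings) of $\phi$; if this supremum is infinite it is set equal to the symbol $\infty$. For an abelian group $G$, $s(G)=\sup\{s(\phi):\phi\in\mathrm{End}(G)\}$, $ns(G)=\sup\{ns(\phi):\phi\in\mathrm{End}(G)\}$, $s_0(G)=\sup\{s_0(\phi):\phi\in\mathrm{End}(G)\}$. An abelian group $G$ is endorigid if $\mathrm{End}(G)=\mathbb Z$, i.e. the ring $\mathrm{End}(G)$ is isomorphic to $\mathbb Z$ (every endomorphism is multiplication by a unique integer). For a prime $p$, $p^\omega G=\bigcap_{n\in\mathbb N}p^nG$. *)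

(* Defs.v *)
From HB Require Import structures.
From mathcomp Require Import all_boot all_order all_algebra.
From mathcomp Require Import all_classical all_reals all_analysis.

Set Implicit Arguments.
Unset Strict Implicit.
Unset Printing Implicit Defensive.

Import Order.TTheory GRing.Theory Num.Theory.
Local Open Scope classical_set_scope.
Local Open Scope ring_scope.

(* Abelian groups are [zmodType]s; End(G) is [{additive G -> G}], made into a
   ring with pointwise addition and composition as product.  It is only a
   [pzRingType], since End(0) is the zero ring. *)
Definition endo (G : zmodType) := {additive G -> G}.

Section EndoRing.
Variable G : zmodType.
Implicit Types f g h : endo G.

HB.instance Definition _ := gen_eqMixin (endo G).
HB.instance Definition _ := gen_choiceMixin (endo G).

Lemma endoP f g : (f : G -> G) =1 g -> f = g.
Proof.
case: f g => [f [[ff]]] [g [[gf]]] /= /funext fg; subst g.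
by rewrite (Prop_irrelevance ff gf).
Qed.

Definition endo_zero : endo G := (\0 : G -> G).
Definition endo_one : endo G := (idfun : G -> G).
Definition endo_opp f : endo G := (\- f : G -> G).
Definition endo_add f g : endo G := (f \+ g : G -> G).
Definition endo_mul f g : endo G := (f \o g : G -> G).

Fact endo_addA : associative endo_add.
Proof. by move=> f g h; apply: endoP => x; exact: addrA. Qed.
Fact endo_addC : commutative endo_add.
Proof. by move=> f g; apply: endoP => x; exact: addrC. Qed.
Fact endo_add0 : left_id endo_zero endo_add.
Proof. by move=> f; apply: endoP => x; exact: add0r. Qed.
Fact endo_addN : left_inverse endo_zero endo_opp endo_add.
Proof. by move=> f; apply: endoP => x; exact: addNr. Qed.
HB.instance Definition _ :=
  GRing.isZmodule.Build (endo G) endo_addA endo_addC endo_add0 endo_addN.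

Fact endo_mulA : associative endo_mul.
Proof. by move=> f g h; apply: endoP. Qed.
Fact endo_mul1l : left_id endo_one endo_mul.
Proof. by move=> f; apply: endoP. Qed.
Fact endo_mul1r : right_id endo_one endo_mul.
Proof. by move=> f; apply: endoP. Qed.
Fact endo_mulDl : left_distributive endo_mul +%R.
Proof. by move=> f g h; apply: endoP. Qed.
Fact endo_mulDr : right_distributive endo_mul +%R.
Proof. by move=> f g h; apply: endoP => x; exact: raddfD. Qed.
HB.instance Definition _ := GRing.Zmodule_isPzRing.Build (endo G)
  endo_mulA endo_mul1l endo_mul1r endo_mulDl endo_mulDr.

End EndoRing.

(* A unital ring morphism from int is necessarily m |-> m.id, so this also says
   that every endomorphism is multiplication by a unique integer. *)
Definition endorigid (G : zmodType) : Prop :=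
  exists theta : {rmorphism int -> endo G}, bijective theta.

Definition torsion_free (G : zmodType) : Prop :=
  forall (n : nat) (x : G), (0 < n)%N -> x *+ n = 0 -> x = 0.

(* p^omega G *)
Definition pomega (p : nat) (G : zmodType) : set G :=
  \bigcap_(n in [set: nat]) range (fun y : G => y *+ (p ^ n)%N).
Arguments pomega : clear implicits.

Section Strings.
Variables (G : zmodType) (phi : endo G).

Definition is_string (x : nat -> G) : Prop :=
  injective x /\ forall n : nat, (0 < n)%N -> phi (x n) = x n.-1.

Definition singular_string (x : nat -> G) : Prop :=
  is_string x /\
  exists j k : nat, j <> k /\ iter j phi (x 0%N) = iter k phi (x 0%N).

Definition nonsingular_string (x : nat -> G) : Prop :=
  is_string x /\ ~ singular_string x.

Definition null_string (x : nat -> G) : Prop :=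
  [/\ is_string x, x 0%N <> 0 &
      exists k : nat, (0 < k)%N /\ iter k phi (x 0%N) = 0].

End Strings.

(* The supremum of |F| over the sets F of pairwise disjoint sequences satisfying
   P.  [counting F] is the cardinality of F when F is finite and +oo otherwise;
   +oo plays the role of the symbol oo.  Disjointness of sequences is that of
   their sets of terms; the empty F makes the supremum nonnegative. *)
Definition sup_disjoint (R : realType) (G : zmodType) (P : set (nat -> G)) :
    \bar R :=
  ereal_sup [set counting F | F in
    [set F : set (nat -> G) | F `<=` P /\ trivIset F (fun x => range x)]].

Definition s_endo (R : realType) (G : zmodType) (phi : endo G) : \bar R :=
  sup_disjoint R (is_string phi).
Definition ns_endo (R : realType) (G : zmodType) (phi : endo G) : \bar R :=
  sup_disjoint R (nonsingular_string phi).
Definition s0_endo (R : realType) (G : zmodType) (phi : endo G) : \bar R :=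
  sup_disjoint R (null_string phi).

Definition s_group (R : realType) (G : zmodType) : \bar R :=
  ereal_sup (range (@s_endo R G)).
Definition ns_group (R : realType) (G : zmodType) : \bar R :=
  ereal_sup (range (@ns_endo R G)).
Definition s0_group (R : realType) (G : zmodType) : \bar R :=
  ereal_sup (range (@s0_endo R G)).

(* Main.v *)
Require Import Defs.
From mathcomp Require Import all_boot all_order all_algebra.
From mathcomp Require Import all_classical all_reals all_analysis.
Local Open Scope classical_set_scope.
Local Open Scope ring_scope.

(** Endorigidity makes every endomorphism a multiplication by some integer [m],
    so everything reduces to the strings of [x |-> m x] on a torsion-free group.
    If [m] is [0], [1] or [-1], a sequence with [m * x (n + 1) = x n] repeats
    within its first three terms, so a string forces [2 <= |m|]; it also forces
    [x 0 <> 0], as division by [m <> 0] is unique ([string_mulrz]).  The powers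
    of such an [m] are nonzero and pairwise distinct, hence so are the elements
    [m ^ k * x 0]: a string is neither null nor singular, which gives [s0 = 0]
    and [s = ns].

    The suprema vanish exactly when there is nothing to count
    ([sup_endo_disjoint_eq0]), so (a) says that no endomorphism has a string.
    Given a string of multiplication by [m] and a prime [p] dividing [m], the
    relation [x 0 = m ^ n * x n] puts [x 0 <> 0] in [p^omega G].  Conversely,
    for a nonzero [x] in [p^omega G], the solutions [y n] of [p ^ n * y n = x]
    form a string of multiplication by [p]. *)

Set Implicit Arguments.
Unset Strict Implicit.
Unset Printing Implicit Defensive.

Import Order.TTheory GRing.Theory Num.Theory.

Lemma counting_set0 (R : realType) (T : choiceType) :
  counting (set0 : set T) = 0%E :> \bar R.
Proof. by rewrite /counting asboolT ?fset_set0. Qed.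

Lemma sup_disjoint_ge0 (R : realType) (G : zmodType) (P : set (nat -> G)) :
  (0 <= sup_disjoint R P)%E.
Proof.
apply: ereal_sup_ubound; exists set0; last exact: counting_set0.
by split=> // x y [].
Qed.

(** A single element of [P] is already a disjoint family, of cardinality [1]. *)
Lemma sup_disjoint_eq0 (R : realType) (G : zmodType) (P : set (nat -> G)) :
  sup_disjoint R P = 0%E <-> P = set0.
Proof.
split=> [P0|->].
  apply/seteqP; split=> // x Px.
  have : ((1%:E : \bar R) <= sup_disjoint R P)%E.
    apply: ereal_sup_ubound; exists [set x].
      by split=> [y ->//|y z /= -> ->].
    by rewrite /counting asboolT ?fset_set1 ?finmap.cardfs1.
  by rewrite P0 lee_fin ler10.
apply/eqP; rewrite eq_le sup_disjoint_ge0 andbT.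
apply: ge_ereal_sup => _ [F [+ _] <-]; rewrite subset0 => ->.
by rewrite counting_set0.
Qed.

Lemma sup_endo_disjoint_eq0 (R : realType) (G : zmodType)
    (P : endo G -> set (nat -> G)) :
  ereal_sup (range (fun phi => sup_disjoint R (P phi))) = 0%E <->
  forall phi, P phi = set0.
Proof.
split=> [P0 phi|P0].
  apply/(sup_disjoint_eq0 R)/eqP; rewrite eq_le sup_disjoint_ge0 andbT -P0.
  by apply: ereal_sup_ubound; exists phi.
have supP0 phi : sup_disjoint R (P phi) = 0%E by apply/sup_disjoint_eq0.
apply/eqP; rewrite eq_le; apply/andP; split.
  by apply: ge_ereal_sup => _ [phi _ <-]; rewrite supP0.
by rewrite -(supP0 0); apply: ereal_sup_ubound; exists 0.
Qed.

Lemma endo_natr (G : zmodType) (n : nat) (x : G) :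
  (n%:R : endo G) x = x *+ n.
Proof.
elim: n => [//|n IHn].
by rewrite mulrS -[LHS]/(x + (n%:R : endo G) x) IHn mulrS.
Qed.

Lemma endo_intr (G : zmodType) (m : int) (x : G) :
  (m%:~R : endo G) x = x *~ m.
Proof.
case: m => n; first exact: endo_natr.
by rewrite -[LHS]/(- (n.+1%:R : endo G) x) endo_natr.
Qed.

Lemma endorigid_mulrz (G : zmodType) (phi : endo G) :
  endorigid G -> exists m : int, forall x, phi x = x *~ m.
Proof.
case=> theta [sigma _ sigmaK]; exists (sigma phi) => x.
by rewrite -endo_intr -(rmorph_int theta) intz sigmaK.
Qed.

Lemma torsion_free_mulrz (G : zmodType) (x : G) (m : int) :
  torsion_free G -> m != 0 -> x *~ m = 0 -> x = 0.
Proof.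
move=> tfG; case: m => n m0 /eqP.
  by rewrite -[_ *~ _]/(x *+ n) => /eqP; apply: tfG; rewrite lt0n.
by rewrite NegzE mulrNz oppr_eq0 => /eqP; exact: tfG.
Qed.

Lemma torsion_free_mulrzI (G : zmodType) (x y : G) (m : int) :
  torsion_free G -> m != 0 -> x *~ m = y *~ m -> x = y.
Proof.
move=> tfG m0 /eqP; rewrite -subr_eq0 -mulrzBl => /eqP.
move/(torsion_free_mulrz tfG m0).
by move/eqP; rewrite subr_eq0 => /eqP.
Qed.

Section StringsOfMultiplications.
Variables (G : zmodType) (phi : endo G) (m : int).
Hypotheses (tfG : torsion_free G) (phiE : forall x, phi x = x *~ m).

Lemma iter_mulrz (k : nat) (x : G) : iter k phi x = x *~ (m ^+ k).
Proof.
by elim: k => [|k IHk]; rewrite ?expr0 ?mulr1z // iterS IHk phiE exprSr mulrzA.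
Qed.

Lemma string_mulrzX (x : nat -> G) (n : nat) :
  is_string phi x -> x 0%N = x n *~ (m ^+ n).
Proof.
case=> _ xS; elim: n => [|n IHn]; first by rewrite expr0 mulr1z.
by rewrite IHn exprS mulrzA -phiE xS.
Qed.

(** The distinctness of [x 0], [x 1] and [x 2] alone rules out the multipliers
    [0], [1] and [-1], which are the only integers with two equal powers. *)
Lemma string_mulrz (x : nat -> G) :
  is_string phi x -> (1 < `|m|)%N /\ x 0%N != 0.
Proof.
move=> [x_inj xS].
have x10 : x 1%N *~ m = x 0%N by rewrite -phiE xS.
have x21 : x 2%N *~ m = x 1%N by rewrite -phiE xS.
have m0 : m != 0.
  apply/eqP => m0; suff : 0%N = 1%N by [].
  by apply: x_inj; rewrite -x10 -x21 m0 !mulr0z.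
split; last first.
  apply/eqP => x0; suff : 0%N = 1%N by [].
  by apply: x_inj; rewrite x0 (torsion_free_mulrz tfG m0 (etrans x10 x0)).
rewrite ltn_neqAle lt0n absz_eq0 m0 andbT eq_sym; apply/eqP => m1.
suff : 0%N = 2%N by [].
(* [m] is [1] or [-1], so [x 0 = m ^ 2 * x 2 = x 2] *)
by apply: x_inj; rewrite -x10 -x21 -mulrzA -expr2
  -[m ^+ 2]real_normK ?num_real // -abszE m1 expr1n mulr1z.
Qed.

Lemma null_string_mulrz : null_string phi = set0.
Proof.
apply/seteqP; split=> // x [/string_mulrz [m1 _] x0 [k [_]]].
rewrite iter_mulrz => /(torsion_free_mulrz tfG) xk; apply: x0; apply: xk.
by rewrite expf_neq0 // -absz_eq0 -lt0n ltnW.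
Qed.

Lemma nonsingular_string_mulrz : nonsingular_string phi = is_string phi.
Proof.
apply/seteqP; split=> x; first by case.
move=> xstr; split=> // -[_ [j [k [neq_jk eq_jk]]]]; apply: neq_jk.
have [m1 x0] := string_mulrz xstr; apply/eqP.
rewrite -(eqn_exp2l _ _ m1) -!abszX; apply: contraNT x0 => neq_mjk.
apply/eqP; apply: (@torsion_free_mulrz _ _ (m ^+ j - m ^+ k)) => //.
  by rewrite subr_eq0; apply: contraNneq neq_mjk => ->.
by rewrite mulrzBr -!iter_mulrz eq_jk subrr.
Qed.

Lemma string_pomega (p : nat) (x : nat -> G) :
  is_string phi x -> (p %| `|m|)%N -> pomega p G (x 0%N).
Proof.
move=> xstr; rewrite -(dvdzE p%:Z m) => /dvdzP [q mqp] n _.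
exists (x n *~ (q ^+ n)) => //.
by rewrite (string_mulrzX n xstr) mqp exprMn mulrzA -[p%:Z]natz
  -natrX natz pmulrn.
Qed.

End StringsOfMultiplications.

(** The elements witnessing that [x] is divisible by each [p ^ n] are chosen
    independently of one another; uniqueness of division in a torsion-free group
    makes them cohere into a backward orbit. *)
Lemma pomega_string (G : zmodType) (p : nat) (x : G) :
  torsion_free G -> (1 < p)%N -> pomega p G x -> x <> 0 ->
  exists y, is_string (p%:R : endo G) y.
Proof.
move=> tfG p1 xp x0.
have /choice [y yE] n : exists z, z *+ (p ^ n)%N = x.
  by have [z _ <-] := xp n I; exists z.
have pX0 n : (p ^ n)%:Z != 0 by rewrite -absz_eq0 -lt0n expn_gt0 ltnW.
exists y; split=> [j k yjk|[//|n] _]; last first.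
  rewrite endo_natr; apply: (torsion_free_mulrzI tfG (pX0 n)).
  by rewrite -!pmulrn -mulrnA -expnS !yE.
(* [z := y j = y k] has [p ^ j * z = x = p ^ k * z]; if [j <> k] this kills [z],
   hence [x] *)
apply/eqP; rewrite -(eqn_exp2l _ _ p1); apply/negPn/negP => neq_jk.
apply: x0; rewrite -(yE j).
rewrite (@torsion_free_mulrz _ (y j) ((p ^ j)%:Z - (p ^ k)%:Z) tfG) ?mul0rn //.
  by rewrite subr_eq0.
by rewrite mulrzBr -!pmulrn yE yjk yE subrr.
Qed.

Theorem theorem4p4 (R : realType) (G : zmodType) :
  endorigid G -> torsion_free G ->
  [/\ s0_group R G = 0%E,
      s_group R G = ns_group R G &
      (s_group R G = 0%E <->
       forall p : nat, prime p -> pomega p G = [set 0])].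
Proof.
move=> rigG tfG; split.
- apply/(sup_endo_disjoint_eq0 R (@null_string G)) => phi.
  have [m phiE] := endorigid_mulrz phi rigG.
  exact: null_string_mulrz tfG phiE.
- suff sE : @s_endo R G = @ns_endo R G by rewrite /s_group sE.
  apply/funext => phi.
  have [m phiE] := endorigid_mulrz phi rigG.
  by rewrite /s_endo /ns_endo (nonsingular_string_mulrz tfG phiE).
- rewrite (sup_endo_disjoint_eq0 R (@is_string G)).
  split=> [nostr p p_prime|p0 phi].
    apply/seteqP; split=> [x xp|_ -> n _]; last by exists 0; rewrite ?mul0rn.
    apply: contrapT => x0.
    have [y] := pomega_string tfG (prime_gt1 p_prime) xp x0.
    by rewrite nostr.
  have [m phiE] := endorigid_mulrz phi rigG.
  apply/seteqP; split=> // x xstr.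
  have [m1 /eqP] := string_mulrz tfG phiE xstr; apply.
  have := string_pomega phiE xstr (pdiv_dvd `|m|).
  by rewrite p0 // pdiv_prime.
Qed.
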